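(* Let $\mathbb{F}_q$ be the finite field with $q$ elements, let $1\le n\le m$ be integers, let $R=\operatorname{map}(\mathbb{A}^n(\mathbb{F}_q),\mathbb{F}_q)$ be the finite set of all functions $\mathbb{A}^n(\mathbb{F}_q)\to\mathbb{F}_q$, and equip the space $R^{nm}$ of $n\times m$ matrices with entries in $R$ with the uniform probability measure $P$. Consider the random variable \[ \gamma_{q,\det}\colon R^{nm}\to[0,1],\qquad \gamma_{q,\det}(M)=\frac{|\{x\in\mathbb{A}^n(\mathbb{F}_q): \operatorname{rank} M(x)<n\}|}{q^n}. \] Then its expectation value is \[ E(\gamma_{q,\det})=1-\prod_{i=0}^{n-1}\left(1-\frac{1}{q^{m-i}}\right)=\frac{1}{q^{m-n+1}}+\dots, \] where the dots denote terms of higher order in $\frac1q$ (i.e. the middle expression, expanded as a polynomial in $\frac1q$, has lowest-order term $\left(\frac1q\right)^{m-n+1}$). The distribution of $\gamma_{q,\det}$ is \[ P\left(\gamma_{q,\det}=\frac{k}{q^n}\right)=\mathcal{B}\left(q^n,E(\gamma_{q,\det}),k\right) \] for every integer $0\le k\le q^n$.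
   Context: $\mathbb{A}^n(\mathbb{F}_q)=\mathbb{F}_q^n$ is the set of $\mathbb{F}_q$-rational points of affine $n$-space. For a matrix $M$ with entries in $R$ and $x\in\mathbb{A}^n(\mathbb{F}_q)$, $M(x)$ is the $n\times m$ matrix over $\mathbb{F}_q$ obtained by evaluating every entry at $x$. The binomial distribution is denoted $\mathcal{B}(N,p,k)=\binom{N}{k}p^k(1-p)^{N-k}$. *)

(* Defs.v *)
From HB Require Import structures.
From mathcomp Require Import all_boot all_order all_algebra.

Set Implicit Arguments.
Unset Strict Implicit.
Unset Printing Implicit Defensive.

Import Order.TTheory GRing.Theory Num.Theory.

Local Open Scope ring_scope.

(* Probabilities and random variables take values in an arbitrary real field K,
   the real numbers being one instance. *)

Definition unif_prob (K : realFieldType) (T : finType) (A : {set T}) : K :=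
  #|A|%:R / #|T|%:R.

Definition expectation (K : realFieldType) (T : finType) (X : T -> K) : K :=
  \sum_(t : T) X t * unif_prob K [set t].

Definition binomial_dist (K : realFieldType) (N : nat) (p : K) (k : nat) : K :=
  'C(N, k)%:R * p ^+ k * (1 - p) ^+ (N - k).

Definition affine_space (F : finFieldType) (n : nat) : finType := 'rV[F]_n.

Definition affine_fun (F : finFieldType) (n : nat) : finType :=
  {ffun affine_space F n -> F}.

Definition eval_mx (F : finFieldType) (n m : nat)
    (M : 'M[affine_fun F n]_(n, m)) (x : affine_space F n) : 'M[F]_(n, m) :=
  \matrix_(i, j) (M i j : {ffun affine_space F n -> F}) x.

Definition gamma_det (K : realFieldType) (F : finFieldType) (n m : nat)
    (M : 'M[affine_fun F n]_(n, m)) : K :=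
  #|[set x : affine_space F n | (\rank (eval_mx M x) < n)%N]|%:R
    / (#|F| ^ n)%:R.

Lemma gamma_det_itv (K : realFieldType) (F : finFieldType) (n m : nat)
    (M : 'M[affine_fun F n]_(n, m)) : 0 <= gamma_det K M <= 1.
Proof.
have q0 : (0 < #|F| ^ n)%N by rewrite expn_gt0 (cardD1 0) inE.
rewrite /gamma_det divr_ge0 ?ler0n //= ler_pdivrMr ?ltr0n // mul1r ler_nat.
by rewrite (leq_trans (max_card _)) // card_mx mul1n.
Qed.

(* The product formula of the expectation as a polynomial in the formal
   variable 'X = 1/q. *)
Definition expectation_poly (K : realFieldType) (n m : nat) : {poly K} :=
  1 - \prod_(i < n) (1 - 'X^(m - i)).

(* Main.v *)
(** Sending a matrix M of functions to the function x |-> M(x) is a bijection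
    onto the functions from affine space to the n x m matrices over F_q, so
    under the uniform measure the values M(x) are independent and uniformly
    distributed.  Hence the number of x with rank M(x) < n is binomial with
    parameters q^n and p, where p is the probability that a uniform n x m matrix
    has dependent rows, and its mean divided by q^n is p.  Choosing the rows one
    at a time gives the number (q^m - 1) ... (q^m - q^(n-1)) of matrices with
    independent rows. *)

Require Import Defs.
From mathcomp Require Import all_boot all_order all_algebra.
From mathcomp Require Import mxabelem zify.

Set Implicit Arguments.
Unset Strict Implicit.
Unset Printing Implicit Defensive.

Import Order.TTheory GRing.Theory Num.Theory.

Local Open Scope ring_scope.

(** A row outside the row space of [B] raises the rank by exactly one; a row inside it leaves the
    rank at most [n], too small for [1 + n] rows. *)
Lemma row_free_col_mx (F : fieldType) (n m : nat) (u : 'rV[F]_m)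
    (B : 'M[F]_(n, m)) :
  row_free (col_mx u B) = row_free B && ~~ (u <= B)%MS.
Proof.
rewrite /row_free -addsmxE.
have [uB | nuB] := boolP (u <= B)%MS.
  rewrite andbF (addsmx_idPr uB); apply/negbTE.
  by rewrite neq_ltn ltnS rank_leq_row.
have -> : \rank (u + B) = (\rank B).+1.
  apply/eqP; rewrite eqn_leq (leq_trans (mxrank_adds_leqif u B)) /=.
    by apply: rank_ltmx; rewrite ltmxE addsmxSr addsmx_sub (negPf nuB).
  by rewrite -[leqRHS]add1n leq_add2r rank_leq_row.
by rewrite andbT.
Qed.

Lemma card_row_free (F : finFieldType) (n m : nat) :
  #|[set A : 'M[F]_(n, m) | row_free A]|
    = (\prod_(i < n) (#|F| ^ m - #|F| ^ i))%N.
Proof.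
elim: n => [|n IHn].
  rewrite big_ord0 (_ : [set _ | _] = setT) ?cardsT ?card_mx ?mul0n //.
  by apply/setP=> A; rewrite !inE /row_free -leqn0 rank_leq_row.
rewrite big_ord_recr /= -{}IHn -[LHS]sum1_card.
(* A matrix with [n.+1] rows is split into its top row and the block [B] below, so that [B] is
   chosen first and the new row second. *)
pose h (p : 'M[F]_(n, m) * 'rV[F]_m) : 'M[F]_(n.+1, m) := col_mx p.2 p.1.
have h_bij : bijective h.
  exists (fun A : 'M_(1 + n, m) => (dsubmx A, usubmx A)) => [[B u]|A].
    by rewrite /h col_mxKu col_mxKd.
  exact: vsubmxK.
rewrite (reindex h) /=; last exact: onW_bij.
rewrite (eq_bigl (fun p => (row_free p.1) && ~~ (p.2 <= p.1)%MS)); last first.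
  by move=> p; rewrite inE row_free_col_mx.
rewrite -(pair_big_dep (fun B => row_free B) (fun B u => ~~ (u <= B)%MS)
  (fun _ _ => 1%N)) /=.
(* For [B] of rank [n], the row space has [#|F| ^ n] vectors, and the new row is any vector outside
   it. *)
rewrite -sum_nat_cond_const; apply: eq_bigr => B /eqP rB.
rewrite sum1_card -[in RHS]rB -card_rowg.
have -> : (#|F| ^ m)%N = #|{: 'rV[F]_m}| by rewrite card_mx mul1n.
rewrite -[rowg B]setCK -cardsCs.
by apply: eq_card => u; rewrite [RHS]in_setC mem_rowg.
Qed.

Lemma unif_prob_row_free (K : realFieldType) (F : finFieldType) (n m : nat) :
  (n <= m)%N ->
  unif_prob K [set A : 'M[F]_(n, m) | row_free A]
    = \prod_(i < n) (1 - 1 / #|F|%:R ^+ (m - i)).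
Proof.
move=> le_nm; rewrite /unif_prob card_row_free card_mx.
have q_gt0 : (0 < #|F|)%N by rewrite (cardD1 0) inE.
have q_neq0 : #|F|%:R != 0 :> K by rewrite pnatr_eq0 -lt0n.
(* The denominator [#|F| ^ (n * m)] is spread over the product, one [#|F| ^ m] under each of the [n]
   factors. *)
rewrite mulnC expnM natrX -[X in _ ^+ X](card_ord n) -prodr_const natr_prod.
rewrite -prodf_div; apply: eq_bigr => i _.
have le_im : (i <= m)%N by rewrite ltnW ?(leq_trans _ le_nm).
rewrite natrB ?leq_pexp2l // mulrBl divff; last by rewrite natrX expf_neq0.
congr (_ - _); rewrite !natrX -[in LHS](subnK le_im) exprD invfM mulrCA.
by rewrite divff ?expf_neq0 // mulr1 div1r.
Qed.

Section FunctionCounting.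

Variables (X T : finType) (P : pred T).

(** Prescribing the preimage [S] is a pointwise condition: [f x] ranges over [P] for [x] in [S] and
    over its complement elsewhere, so the counts multiply. *)
Lemma card_ffun_preim_eq (S : {set X}) :
  #|[set f : {ffun X -> T} | [set x | P (f x)] == S]|
    = (#|P| ^ #|S| * #|predC P| ^ (#|X| - #|S|))%N.
Proof.
pose Q (x : X) : pred T := if x \in S then P else predC P.
rewrite (_ : [set f | _] = [set f in family Q]); last first.
  apply/setP=> f; rewrite !inE /Q; apply/eqP/familyP => [<- x | Qf].
    by rewrite inE; case: ifP => Pfx; rewrite unfold_in /= ?Pfx.
  apply/setP=> x; rewrite inE; have := Qf x.
  by case: ifP => _; rewrite unfold_in //= => /negPf.
rewrite cardsE card_family foldrE big_map big_enum /=.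
rewrite (bigID (mem S)) /= (eq_bigr (fun _ => #|P|)); last first.
  by move=> x; rewrite /Q => ->.
rewrite [X in (_ * X)%N](eq_bigr (fun _ => #|predC P|)); last first.
  by move=> x /negPf xS; rewrite /Q xS.
rewrite !prod_nat_const; congr (_ * _ ^ _)%N.
by rewrite -[S in RHS]setCK -cardsCs; apply: eq_card => x; rewrite !inE.
Qed.

(** Functions are sorted by the preimage [S] of [P]; the count for each [S] depends only on its
    size. *)
Lemma card_ffun_preim_card k :
  #|[set f : {ffun X -> T} | #|[set x | P (f x)]| == k]|
    = ('C(#|X|, k) * (#|P| ^ k * #|predC P| ^ (#|X| - k)))%N.
Proof.
rewrite -sum1_card (partition_big (fun f : {ffun X -> T} => [set x | P (f x)])
  (fun S : {set X} => #|S| == k)) /= => [|f]; last by rewrite inE.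
rewrite -card_draws -sum_nat_cond_const; apply: eq_bigr => S /eqP cS.
rewrite -[in RHS]cS -card_ffun_preim_eq -sum1_card; apply: eq_bigl => f.
by rewrite !inE; case: (_ =P S) => [->|]; rewrite ?cS ?eqxx ?andbF.
Qed.

(** The factor [#|T|] on the left avoids an exponent [#|X| - 1] on the right. *)
Lemma card_ffun_at (x0 : X) :
  (#|[set f : {ffun X -> T} | P (f x0)]| * #|T| = #|P| * #|T| ^ #|X|)%N.
Proof.
pose Q (x : X) : pred T := if x == x0 then P else predT.
rewrite (_ : [set f | _] = [set f in family Q]); last first.
  apply/setP=> f; rewrite !inE; apply/idP/familyP => [Pf x | /(_ x0)].
    by rewrite /Q; case: eqP => [->|].
  by rewrite /Q eqxx.
rewrite cardsE card_family foldrE big_map big_enum /=.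
rewrite (bigD1 x0) //= {1}/Q eqxx (eq_bigr (fun _ => #|T|)); last first.
  by move=> x /negPf nx; rewrite /Q nx.
rewrite prod_nat_const -mulnA -expnSr; congr (_ * _ ^ _)%N.
rewrite (cardD1 x0 X) /= add1n; congr S.
by apply: eq_card => x; rewrite !inE andbT.
Qed.

End FunctionCounting.

Section UniformProbability.

Variable K : realFieldType.

Lemma unif_prob_preim (T1 T2 : finType) (h : T1 -> T2) (Q : pred T2) :
  bijective h -> unif_prob K [set t | Q (h t)] = unif_prob K [set t | Q t].
Proof.
move=> h_bij; rewrite /unif_prob (bij_eq_card h_bij); congr (_%:R / _).
rewrite -(on_card_preimset (R := [set t | Q t]) (onW_bij _ h_bij)).
by apply: eq_card => t; rewrite !inE.
Qed.

Lemma unif_probC (T : finType) (P : pred T) : (0 < #|T|)%N ->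
  unif_prob K [set t | ~~ P t] = 1 - unif_prob K [set t | P t].
Proof.
move=> T_gt0; have T_neq0 : #|T|%:R != 0 :> K by rewrite pnatr_eq0 -lt0n.
have -> : [set t | ~~ P t] = ~: [set t | P t] by apply/setP=> t; rewrite !inE.
apply/eqP; rewrite eq_sym subr_eq addrC /unif_prob -mulrDl -natrD cardsC.
by rewrite divff.
Qed.

Lemma unif_prob_ffun_at (X T : finType) (P : pred T) (x : X) : (0 < #|T|)%N ->
  unif_prob K [set f : {ffun X -> T} | P (f x)] = unif_prob K [set t | P t].
Proof.
move=> T_gt0; have T_neq0 : #|T|%:R != 0 :> K by rewrite pnatr_eq0 -lt0n.
rewrite /unif_prob card_ffun; apply/eqP.
rewrite eqr_div ?natrX ?expf_neq0 // -natrX -!natrM card_ffun_at.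
by rewrite cardsE.
Qed.

Lemma unif_prob_ffun_preim_card (X T : finType) (P : pred T) k :
  (0 < #|T|)%N -> (k <= #|X|)%N ->
  unif_prob K [set f : {ffun X -> T} | #|[set x | P (f x)]| == k]
    = binomial_dist #|X| (unif_prob K [set t | P t]) k.
Proof.
move=> T_gt0 le_kX; have T_neq0 : #|T|%:R != 0 :> K by rewrite pnatr_eq0 -lt0n.
rewrite /binomial_dist -unif_probC // /unif_prob card_ffun_preim_card card_ffun.
(* Splitting the exponent [#|X|] as [k + (#|X| - k)] gives each of the two powers its own share of
   the denominator. *)
rewrite !natrM !natrX -[in X in _ / X](subnKC le_kX) exprD.
by rewrite !expr_div_n !cardsE invfM -!mulrA; congr (_ * (_ * _)); rewrite mulrCA.
Qed.

(** Linearity of expectation: the count is a sum of indicators over [x], and each indicator has the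
    same mean, so no binomial sum is evaluated. The bijection [h] transports this to other encodings
    of functions. *)
Lemma expectation_ffun_preim_card (T1 X T : finType) (h : T1 -> {ffun X -> T})
    (P : pred T) : bijective h -> (0 < #|T|)%N -> (0 < #|X|)%N ->
  expectation (fun t => #|[set x | P (h t x)]|%:R / #|X|%:R)
    = unif_prob K [set t | P t].
Proof.
move=> h_bij T_gt0 X_gt0.
have X_neq0 : #|X|%:R != 0 :> K by rewrite pnatr_eq0 -lt0n.
rewrite /expectation; under eq_bigr => t _ do
  rewrite /unif_prob cards1 -mulrA -sum1_card natr_sum big_mkcond /= mulr_suml.
rewrite exchange_big /=.
rewrite (eq_bigr (fun _ => unif_prob K [set t | P t] / #|X|%:R)); last first.
  move=> x _; rewrite -(unif_prob_ffun_at P x T_gt0).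
  rewrite -(unif_prob_preim (fun f : {ffun X -> T} => P (f x)) h_bij).
  rewrite /unif_prob -[in RHS]sum1_card natr_sum [in RHS]big_mkcond /=.
  by rewrite !mulr_suml; apply: eq_bigr => t _; rewrite !inE mul1r -mulrA [_^-1 / _]mulrC.
by rewrite sumr_const -[LHS]mulr_natr divfK.
Qed.

End UniformProbability.

Definition eval_ffun (F : finFieldType) (n m : nat)
    (M : 'M[affine_fun F n]_(n, m)) : {ffun affine_space F n -> 'M[F]_(n, m)} :=
  [ffun x => eval_mx M x].

Lemma eval_ffun_bij (F : finFieldType) (n m : nat) :
  bijective (@eval_ffun F n m).
Proof.
exists (fun f : {ffun affine_space F n -> 'M[F]_(n, m)} =>
  \matrix_(i, j) ([ffun x => f x i j] : affine_fun F n)).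
  by move=> M; apply/matrixP=> i j; apply/ffunP=> x; rewrite mxE !ffunE mxE.
by move=> f; apply/ffunP=> x; apply/matrixP=> i j; rewrite ffunE !mxE ffunE.
Qed.

(** Modulo ['X^(d.+1)] only the factor with [i = 0] differs from 1; [p] collects all the higher
    terms. *)
Lemma prod_1subXn (R : comNzRingType) (d n : nat) : exists p : {poly R},
  \prod_(i < n.+1) (1 - 'X^(d + i)) = 1 - 'X^d + 'X^(d.+1) * p.
Proof.
elim: n => [|n [p IHn]]; first by exists 0; rewrite big_ord1 addn0 mulr0 addr0.
exists (p - (1 - 'X^d + 'X^(d.+1) * p) * 'X^n).
rewrite big_ord_recr /= {}IHn -addSnnS exprD mulrBr mulr1 mulrBr addrA.
by congr (_ - _); rewrite mulrCA.
Qed.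

Lemma expectation_polyE (K : realFieldType) (n m : nat) : (1 <= n <= m)%N ->
  exists p, expectation_poly K n m = 'X^(m - n + 1) - 'X^((m - n + 1).+1) * p.
Proof.
case: n => // n /= le_nm; have [p Ep] := prod_1subXn K (m - n.+1 + 1) n.
(* Reversing the index makes the exponents increase from [m - n + 1], the exponent of the last
   factor in the original order. *)
exists p; rewrite /expectation_poly (reindex_inj rev_ord_inj) /=.
rewrite (eq_bigr (fun i : 'I_n.+1 => 1 - 'X^(m - n.+1 + 1 + i))) => [|i _].
  by rewrite Ep opprD opprB addrA addrCA subrr addr0.
by congr (1 - 'X^_); have := ltn_ord i; rewrite /=; lia.
Qed.

Theorem corollary3p2 (K : realFieldType) (F : finFieldType) (q n m : nat)
    (hq : #|F| = q) (hn : (1 <= n)%N) (hnm : (n <= m)%N) :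
  let E : K := expectation (@gamma_det K F n m) in
  [/\ E = 1 - \prod_(i < n) (1 - 1 / q%:R ^+ (m - i)),
      [/\ 1 - \prod_(i < n) (1 - 1 / q%:R ^+ (m - i))
            = (expectation_poly K n m).[1 / q%:R],
          (expectation_poly K n m)`_(m - n + 1) = 1
        & forall j : nat, (j < m - n + 1)%N -> (expectation_poly K n m)`_j = 0]
    & forall k : nat, (k <= q ^ n)%N ->
        unif_prob K [set M : 'M[affine_fun F n]_(n, m)
                       | gamma_det K M == k%:R / (q ^ n)%:R]
          = binomial_dist (q ^ n) E k].
Proof.
move=> E; have q_gt0 : (0 < #|F|)%N by rewrite (cardD1 0) inE.
have cardX : #|affine_space F n| = (#|F| ^ n)%N by rewrite card_mx mul1n.
have X_gt0 : (0 < #|affine_space F n|)%N by rewrite cardX expn_gt0 q_gt0.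
have M_gt0 : (0 < #|{: 'M[F]_(n, m)}|)%N by rewrite card_mx expn_gt0 q_gt0.
have singularE (A : 'M[F]_(n, m)) : (\rank A < n)%N = ~~ row_free A.
  by rewrite ltn_neqAle rank_leq_row andbT.
have gammaE (M : 'M[affine_fun F n]_(n, m)) : gamma_det K M
    = #|[set x | ~~ row_free (eval_ffun M x)]|%:R / #|affine_space F n|%:R.
  rewrite /gamma_det cardX; congr (_%:R / _).
  by apply: eq_card => x; rewrite !inE ffunE singularE.
(* The mean is the probability that a single uniform matrix is singular. *)
have EE : E = unif_prob K [set A : 'M[F]_(n, m) | ~~ row_free A].
  rewrite -(expectation_ffun_preim_card _ _ (@eval_ffun_bij F n m)) //.
  by apply: eq_bigr => M _; rewrite gammaE.
have [p Ep] := @expectation_polyE K n m (introT andP (conj hn hnm)).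
split.
- by rewrite EE unif_probC // unif_prob_row_free // hq.
- split.
  + rewrite /expectation_poly hornerD hornerN horner_prod hornerC.
    congr (_ - _); apply: eq_bigr => i _.
    by rewrite hornerD hornerN hornerC hornerXn expr_div_n expr1n.
  + by rewrite Ep coefB coefXn eqxx coefXnM ltnSn subr0.
  + by move=> j lt_j; rewrite Ep coefB coefXn coefXnM ltnW // ltn_eqF // subr0.
- rewrite -hq -cardX => k le_k.
  rewrite EE -unif_prob_ffun_preim_card //.
  rewrite -(unif_prob_preim _ _ (@eval_ffun_bij F n m)).
  congr unif_prob; apply/setP=> M; rewrite !inE gammaE.
  (* Cancelling the common nonzero denominator turns the equation between fractions into one between
     the number of singular points and [k]. *)
  have X_neq0 : #|affine_space F n|%:R != 0 :> K by rewrite pnatr_eq0 -lt0n.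
  by rewrite (inj_eq (divIf X_neq0)) eqr_nat.
Qed.
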